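(* The Chain Prefix Maxgap Problem can be solved in $O(m)$ time using an auxiliary array of size $n$: given pairwise disjoint sets $X_1,\dots,X_k\subseteq\{1,\dots,n\}$ together with the sorted sequence of the elements of $X_1\cup\cdots\cup X_k$, where $m=\sum_i|X_i|$, compute for every $i=1,\dots,k$ the number $$\Delta_i=\max_{j\le i}\ \mathrm{maxgap}(X_j\cup X_{j+1}\cup\cdots\cup X_k).$$
   Context: For a finite set $X$ of integers, $\mathrm{maxgap}(X)$ is the maximum of $b-a$ over consecutive elements $a<b$ of $X$ (consecutive in sorted order), or $0$ if $|X|\le 1$. The input size is $m$.
   Formalization: Time is bounded by O(m+k+1) instead of O(m): empty sets X_i are allowed, and writing k outputs takes k steps (X_1={1,2}, all others empty); for nonempty X_i, k≤m and this is O(m). The auxiliary array has n+1 cells (indices 0..n), zero-initialized. *)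

(* Defs.v *)
From mathcomp Require Import all_boot.
Set Implicit Arguments. Unset Strict Implicit. Unset Printing Implicit Defensive.

Definition maxgap (X : seq nat) : nat :=
  let s := sort leq (undup X) in
  foldr maxn 0 [seq p.2 - p.1 | p <- zip s (behead s)].

(* Delta for the (0-indexed) set i : Xs = [:: X_1; ...; X_k],
   Delta Xs i = max_{j <= i} maxgap (X_{j+1} u ... u X_k)  (0-indexed). *)
Definition Delta (Xs : seq (seq nat)) (i : nat) : nat :=
  \max_(j < i.+1) maxgap (flatten (drop j Xs)).

(* A unit-cost RAM model: a structured imperative language over          *)
(* unbounded natural-number registers and memory cells, with addition,  *)
(* truncated subtraction, comparisons and indirect memory access.        *)
Inductive aexp :=
| ANum of nat
| AReg of nat
| AAdd of aexp & aexp
| ASub of aexp & aexp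
| ALoad of aexp.

Inductive bexp :=
| BLt of aexp & aexp
| BEq of aexp & aexp
| BNot of bexp
| BAnd of bexp & bexp.

Inductive cmd :=
| CSkip
| CAssign of nat & aexp
| CStore of aexp & aexp
| CSeq of cmd & cmd
| CIf of bexp & cmd & cmd
| CWhile of bexp & cmd.

Definition state := ((nat -> nat) * (nat -> nat))%type. (* registers, memory *)

Fixpoint aeval (B : nat) (st : state) (a : aexp) : option nat :=
  match a with
  | ANum v => Some v
  | AReg r => Some (st.1 r)
  | AAdd a1 a2 =>
      match aeval B st a1, aeval B st a2 with
      | Some x, Some y => Some (x + y) | _, _ => None end
  | ASub a1 a2 =>
      match aeval B st a1, aeval B st a2 with
      | Some x, Some y => Some (x - y) | _, _ => None end
  | ALoad a1 =>
      match aeval B st a1 with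
      | Some p => if p < B then Some (st.2 p) else None
      | None => None end
  end.

Fixpoint beval (B : nat) (st : state) (b : bexp) : option bool :=
  match b with
  | BLt a1 a2 =>
      match aeval B st a1, aeval B st a2 with
      | Some x, Some y => Some (x < y) | _, _ => None end
  | BEq a1 a2 =>
      match aeval B st a1, aeval B st a2 with
      | Some x, Some y => Some (x == y) | _, _ => None end
  | BNot b1 => omap negb (beval B st b1)
  | BAnd b1 b2 =>
      match beval B st b1, beval B st b2 with
      | Some x, Some y => Some (x && y) | _, _ => None end
  end.

Definition upd (f : nat -> nat) (x v : nat) : nat -> nat :=
  fun y => if y == x then v else f y.

Inductive exec (B : nat) : cmd -> state -> nat -> state -> Prop :=
| ESkip st : exec B CSkip st 1 st
| EAssign st r a v :
    aeval B st a = Some v -> exec B (CAssign r a) st 1 (upd st.1 r v, st.2)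
| EStore st a e p v :
    aeval B st a = Some p -> p < B -> aeval B st e = Some v ->
    exec B (CStore a e) st 1 (st.1, upd st.2 p v)
| ESeq c1 c2 st st1 st2 t1 t2 :
    exec B c1 st t1 st1 -> exec B c2 st1 t2 st2 ->
    exec B (CSeq c1 c2) st (t1 + t2) st2
| EIfT b c1 c2 st t st' :
    beval B st b = Some true -> exec B c1 st t st' ->
    exec B (CIf b c1 c2) st t.+1 st'
| EIfF b c1 c2 st t st' :
    beval B st b = Some false -> exec B c2 st t st' ->
    exec B (CIf b c1 c2) st t.+1 st'
| EWhileT b c st st1 st2 t1 t2 :
    beval B st b = Some true -> exec B c st t1 st1 ->
    exec B (CWhile b c) st1 t2 st2 ->
    exec B (CWhile b c) st (t1 + t2).+1 st2
| EWhileF b c st :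
    beval B st b = Some false -> exec B (CWhile b c) st 1 st.

(* Input encoding for an instance (n, Xs = [:: X_1; ...; X_k]).          *)
(*  mem[0] = n, mem[1] = k, mem[2] = m,                                  *)
(*  mem[3 .. 3+m-1]   = sorted sequence of the elements of the union,    *)
(*  mem[3+m+2i], mem[3+m+2i+1] = start address and size of the list of   *)
(*                      X_{i+1} (0 <= i < k),                            *)
(*  then the lists of X_1, ..., X_k, consecutively.                      *)
(* Everything beyond is 0 initially.                                     *)
Definition list_base (Xs : seq (seq nat)) : nat :=
  3 + size (flatten Xs) + 2 * size Xs.

Definition input_layout (n : nat) (Xs : seq (seq nat)) : seq nat :=
  [:: n; size Xs; size (flatten Xs)]
  ++ sort leq (flatten Xs)
  ++ flatten [seq [:: list_base Xs + sumn (map size (take i Xs));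
                      size (nth [::] Xs i)] | i <- iota 0 (size Xs)]
  ++ flatten Xs.

Definition init_state (n : nat) (Xs : seq (seq nat)) : state :=
  (fun _ => 0, fun a => nth 0 (input_layout n Xs) a).

(* Outputs Delta_1..Delta_k go to mem[out_addr + 0 .. out_addr + k-1]. *)
Definition out_addr (n : nat) (Xs : seq (seq nat)) : nat :=
  size (input_layout n Xs).

(* Memory available: the input, the k output cells, and an auxiliary
   array of n+1 cells (indices 0..n, i.e. size n up to an additive 1). *)
Definition mem_bound (n : nat) (Xs : seq (seq nat)) : nat :=
  out_addr n Xs + size Xs + n.+1.

(* Main.v *)
(* Label every element with the (1-based) index [group x] of its set, using the
   auxiliary array.  Two elements [a < b] are consecutive in the union of the sets
   of 0-based index at least [j] iff the labels between them are all [<= j] and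
   those of [a], [b] are [> j], so the gap [b - a] contributes to [Delta i] exactly
   when [i >= M], the largest label strictly between [a] and [b] (0 if there is
   none), provided that [M] is below both labels.  Scanning the sorted sequence
   with a stack of strictly decreasing labels finds all these pairs in linear
   time; keeping the largest gap for each [M] in output cell [M], a final
   prefix-maximum pass gives the answer. *)

Require Import Defs.
From mathcomp Require Import all_boot.
From mathcomp Require Import zify.

Set Implicit Arguments. Unset Strict Implicit. Unset Printing Implicit Defensive.

(** * Weakest preconditions with time credits for the RAM language *)

Fixpoint awp (B : nat) (st : state) (a : aexp) (K : nat -> Prop) : Prop :=
  match a with
  | ANum v => K v
  | AReg r => K (st.1 r)
  | AAdd a1 a2 => awp B st a1 (fun x => awp B st a2 (fun y => K (x + y)))
  | ASub a1 a2 => awp B st a1 (fun x => awp B st a2 (fun y => K (x - y)))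
  | ALoad a1 => awp B st a1 (fun p => p < B /\ K (st.2 p))
  end.

Fixpoint bwp (B : nat) (st : state) (b : bexp) (K : bool -> Prop) : Prop :=
  match b with
  | BLt a1 a2 => awp B st a1 (fun x => awp B st a2 (fun y => K (x < y)))
  | BEq a1 a2 => awp B st a1 (fun x => awp B st a2 (fun y => K (x == y)))
  | BNot b1 => bwp B st b1 (fun x => K (~~ x))
  | BAnd b1 b2 => bwp B st b1 (fun x => bwp B st b2 (fun y => K (x && y)))
  end.

(* Weakest precondition with time credits: [m] is the number of steps that may
   still be spent, and the postcondition receives the credits left over. *)
Fixpoint cwp (B : nat) (c : cmd) (Q : nat -> state -> Prop) (m : nat)
    (st : state) : Prop :=
  match c with
  | CSkip => 0 < m /\ Q m.-1 st
  | CAssign r a => awp B st a (fun v => 0 < m /\ Q m.-1 (upd st.1 r v, st.2))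
  | CStore a e =>
      awp B st a (fun p => p < B /\ awp B st e (fun v =>
        0 < m /\ Q m.-1 (st.1, upd st.2 p v)))
  | CSeq c1 c2 => cwp B c1 (cwp B c2 Q) m st
  | CIf b c1 c2 =>
      0 < m /\ bwp B st b (fun v =>
        if v then cwp B c1 Q m.-1 st else cwp B c2 Q m.-1 st)
  | CWhile b c1 =>
      exists2 I : nat -> state -> Prop, I m st &
        forall m' st', I m' st' -> 0 < m' /\ bwp B st' b (fun v =>
          if v then cwp B c1 I m'.-1 st' else Q m'.-1 st')
  end.

Lemma awp_sound B st a K : awp B st a K -> exists2 v, aeval B st a = Some v & K v.
Proof.
elim: a K => [v|r|a1 IH1 a2 IH2|a1 IH1 a2 IH2|a1 IH1] K /=; try by eexists.
- by move=> /IH1[x -> /IH2[y -> ?]]; exists (x + y).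
- by move=> /IH1[x -> /IH2[y -> ?]]; exists (x - y).
- by move=> /IH1[p -> [-> ?]]; exists (st.2 p).
Qed.

Lemma bwp_sound B st b K : bwp B st b K -> exists2 v, beval B st b = Some v & K v.
Proof.
elim: b K => [a1 a2|a1 a2|b IH|b1 IH1 b2 IH2] K /=.
- by move=> /awp_sound[x -> /awp_sound[y -> ?]]; exists (x < y).
- by move=> /awp_sound[x -> /awp_sound[y -> ?]]; exists (x == y).
- by move=> /IH[x -> ?]; exists (~~ x).
- by move=> /IH1[x -> /IH2[y -> ?]]; exists (x && y).
Qed.

Lemma cwp_sound B c Q m st : cwp B c Q m st ->
  exists t st', [/\ exec B c st t st', t <= m & Q (m - t) st'].
Proof.
elim: c Q m st => [|r a|a e|c1 IH1 c2 IH2|b c1 IH1 c2 IH2|b c IH] Q m st /=.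
- by case=> m0 q; exists 1, st; rewrite subn1; split=> //; constructor.
- move=> /awp_sound[v ev [m0 q]]; exists 1, (upd st.1 r v, st.2).
  by rewrite subn1; split=> //; constructor.
- move=> /awp_sound[p ep [pB /awp_sound[v ev [m0 q]]]].
  exists 1, (st.1, upd st.2 p v); rewrite subn1; split=> //.
  exact: EStore ep pB ev.
- move=> /IH1[t1 [st1 [e1 le1 /IH2[t2 [st2 [e2 le2 q]]]]]].
  exists (t1 + t2), st2; rewrite subnDA; split=> //; last lia.
  exact: ESeq e1 e2.
- case=> m0 /bwp_sound[[] eb].
  + move=> /IH1[t [st' [e le q]]]; exists t.+1, st'; split; [exact: EIfT|lia|].
    by have -> : m - t.+1 = m.-1 - t by lia.
  + move=> /IH2[t [st' [e le q]]]; exists t.+1, st'; split; [exact: EIfF|lia|].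
    by have -> : m - t.+1 = m.-1 - t by lia.
- case=> I I0 step.
  (* Every loop test spends a credit, so strong induction on the credits gives termination without a
     separate variant. *)
  elim/ltn_ind: m st I0 => m IHm st /step[m0 /bwp_sound[[] eb]].
  + move=> /IH[t1 [st1 [e1 le1 I1]]].
    have [|t2 [st2 [e2 le2 q]]] := IHm _ _ _ I1; first lia.
    exists (t1 + t2).+1, st2; split; [exact: EWhileT eb e1 e2|lia|].
    by have -> : m - (t1 + t2).+1 = m.-1 - t1 - t2 by lia.
  + by move=> q; exists 1, st; rewrite subn1; split=> //; constructor.
Qed.

(** * Gaps, labels and suffix unions *)

Definition gaps_max (s : seq nat) : nat :=
  foldr maxn 0 [seq p.2 - p.1 | p <- zip s (behead s)].

(* For empty [s] the new gap is [b - b = 0]. *)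
Lemma gaps_max_rcons s b :
  gaps_max (rcons s b) = maxn (gaps_max s) (b - last b s).
Proof.
rewrite /gaps_max; case: s => [|a s]; first by rewrite /= subnn.
rewrite rcons_cons /=; elim: s a => [|a' s IH] a /=; first by rewrite maxnC.
by rewrite IH maxnA.
Qed.

Definition group (Xs : seq (seq nat)) (x : nat) : nat :=
  (find (fun X => x \in X) Xs).+1.

Lemma group_le (Xs : seq (seq nat)) x : x \in flatten Xs -> group Xs x <= size Xs.
Proof. by rewrite /group -has_find => /flattenP[X ? ?]; apply/hasP; exists X. Qed.

Lemma mem_flatten_drop (Xs : seq (seq nat)) j x : uniq (flatten Xs) -> x \in flatten Xs ->
  (x \in flatten (drop j Xs)) = (j < group Xs x).
Proof.
rewrite /group; elim: Xs j => [|X Xs IH] [|j] //= uX xX.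
move: uX xX; rewrite cat_uniq mem_cat => /and3P[_ /hasPn disj uXs].
case: ifPn => [xX _|xX /= xXs]; last exact: IH.
apply/negP=> xd; have /disj/negP[//] : x \in flatten Xs.
by rewrite -(cat_take_drop j Xs) flatten_cat mem_cat xd orbT.
Qed.

Lemma group_nth (Xs : seq (seq nat)) i x : uniq (flatten Xs) -> x \in nth [::] Xs i ->
  group Xs x = i.+1.
Proof.
rewrite /group; elim: Xs i => [|X Xs IH] [|i] //=; rewrite ?cat_uniq.
- by move=> _ ->.
- move=> /and3P[_ /hasPn disj uXs] xi; rewrite (IH i) //.
  have iXs : i < size Xs by rewrite ltnNge; apply: contraL xi => ?; rewrite nth_default.
  have /disj/negbTE -> // : x \in flatten Xs.
  by apply/flattenP; exists (nth [::] Xs i); rewrite ?mem_nth.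
Qed.

(** All suffix unions are read off a single sorted sequence: filtering keeps it sorted, and a sorted
    list is determined by its elements up to permutation. *)
Lemma maxgap_suffix (Xs : seq (seq nat)) j : uniq (flatten Xs) ->
  maxgap (flatten (drop j Xs)) =
  gaps_max [seq x <- sort leq (flatten Xs) | j < group Xs x].
Proof.
move=> uX; rewrite /maxgap -/(gaps_max _); congr gaps_max.
have uD : uniq (flatten (drop j Xs)).
  by move: uX; rewrite -{1}(cat_take_drop j Xs) flatten_cat cat_uniq => /and3P[].
apply: (sorted_eq leq_trans anti_leq).
- exact: sort_sorted leq_total _.
- exact/sorted_filter/sort_sorted/leq_total/leq_trans.
- rewrite perm_sort undup_id //; apply: uniq_perm => //.
    by rewrite filter_uniq ?sort_uniq.
  move=> x; rewrite mem_filter mem_sort.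
  case xX : (x \in flatten Xs); first by rewrite andbT mem_flatten_drop.
  rewrite andbF; apply/negP=> xd; move: xX.
  by rewrite -(cat_take_drop j Xs) flatten_cat mem_cat xd orbT.
Qed.

(** * Invariants of the stack scan *)

(* [M] is how far the new element [b] has been compared with the stack: the
   suffixes [j < M] already account for the gap ending at [b], and every stacked
   element belongs to the suffixes [j <= M]. *)
Definition stack_inv (g : nat -> nat) (F : seq nat) (M : nat) (stk : seq nat) :=
  [/\ all (fun x => M < g x) stk, pairwise (fun x y => g y < g x) stk &
      forall j d, M <= j ->
        last d [seq x <- F | j < g x] = last d [seq x <- stk | j < g x]].

(** Equality of two prefix maxima, phrased as having the same upper bounds [v]. Single cells are not
    compared, because a gap is recorded only at the least threshold [j] for which it occurs. *)
Definition gap_inv (k : nat) (g : nat -> nat) (F : seq nat) (b M : nat)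
    (out : nat -> nat) :=
  forall i v, i < k ->
    (forall j, j <= i -> out j <= v) <->
    (forall j, j <= i -> gaps_max [seq x <- F | j < g x] <= v /\
       (j < M -> b - last b [seq x <- F | j < g x] <= v)).

(** Thresholds [j >= g a] filter [a] out anyway, and the labels below it on the stack exceed
    [g a]. *)
Lemma stack_inv_pop g F M stk a :
  stack_inv g F M (rcons stk a) -> stack_inv g F (g a) stk.
Proof.
case; rewrite all_rcons pairwise_rcons => /andP[Ma _] /andP[alla pw] lastE.
split=> // j d aj; rewrite lastE ?filter_rcons; last exact: leq_trans (ltnW Ma) aj.
by rewrite ltnNge aj.
Qed.

(** The top carries the smallest label, so [M' < g a] bounds the whole stack. *)
Lemma stack_inv_stop g F M stk a M' :
  M <= M' < g a -> stack_inv g F M (rcons stk a) ->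
  stack_inv g F M' (rcons stk a).
Proof.
move=> /andP[MM' M'a] [_ pw lastE]; split=> // [|j d M'j]; last first.
  by apply: lastE; exact: leq_trans M'j.
move: pw; rewrite all_rcons pairwise_rcons M'a => /andP[alla _].
by apply: sub_all alla => x; exact: ltn_trans.
Qed.

(** If [M = g b], all stacked labels exceed [g b] and the order survives. For [j < g b] both last
    elements become [b]; for other [j] the old invariant applies, as [M <= g b]. *)
Lemma stack_inv_push g F M stk b :
  M <= g b -> 0 < g b ->
  M = g b \/ stk = [::] -> stack_inv g F M stk ->
  stack_inv g (rcons F b) 0 (rcons stk b).
Proof.
move=> Mb b0 Mstk [allM pw lastE]; split.
- rewrite all_rcons b0; apply: sub_all allM => x; exact: leq_ltn_trans.
- rewrite pairwise_rcons pw andbT; case: Mstk allM => [-> //|-> //].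
- move=> j d _; rewrite !filter_rcons; case: ltnP => jb; first by rewrite !last_rcons.
  by apply: lastE; exact: leq_trans jb.
Qed.

Lemma stack_inv_last g F M stk a j d : M <= j < g a ->
  stack_inv g F M (rcons stk a) -> last d [seq x <- F | j < g x] = a.
Proof. by move=> /andP[Mj ja] [_ _ ->] //; rewrite filter_rcons ja last_rcons. Qed.

(** Writing [b - a] to cell [M] alone serves all thresholds in [[M, M')]: a prefix reaching such a
    [j] also contains [M]. *)
Lemma gap_inv_advance k g F b M M' a out out' :
  M < M' -> M < k ->
  (forall j, M <= j < M' -> last b [seq x <- F | j < g x] = a) ->
  (forall j, j < k -> out' j = if j == M then maxn (out M) (b - a) else out j) ->
  gap_inv k g F b M out -> gap_inv k g F b M' out'.
Proof.
move=> MM' Mk lastE outE inv i v ik; split=> [le_out j ji | le_gap j ji].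
- have le_out' j' : j' <= i -> out j' <= v.
    move=> j'i; have := le_out j' j'i; rewrite outE; last lia.
    by case: eqP => [->|] //; lia.
  have /(inv _ _ ik)/(_ j ji)[leF leM] := le_out'; split=> // jM'.
  have [jM|Mj] := ltnP j M; first exact: leM.
  rewrite lastE ?Mj //; have := le_out M (leq_trans Mj ji).
  by rewrite outE // eqxx geq_max => /andP[].
- have out_le j' : j' <= i -> out j' <= v.
    apply: (iffRL (inv i v ik)) j' => j' j'i; have [leF leM] := le_gap j' j'i.
    by split=> // j'M; apply: leM; exact: ltn_trans MM'.
  rewrite outE; last exact: leq_ltn_trans ik.
  case: eqP ji => [-> Mi|_]; last exact: out_le.
  rewrite geq_max out_le //=; have [_ /(_ MM')] := le_gap M Mi.
  by rewrite lastE // leqnn.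
Qed.

(** The suffixes containing [b] are those with [j < g b]. Those with [j < M] have counted its gap;
    any others occur only with an empty stack, where [b] has no predecessor and the default of
    [last] makes the gap 0. *)
Lemma gap_inv_push k g F b M stk out b' :
  M <= g b -> M = g b \/ stk = [::] -> stack_inv g F M stk ->
  gap_inv k g F b M out -> gap_inv k g (rcons F b) b' 0 out.
Proof.
move=> Mb Mstk [_ _ lastE] inv i v ik; rewrite inv //.
split=> le_gap j ji; have := le_gap j ji; rewrite filter_rcons.
- case=> leF leM; split=> //; case: ifP => // jb.
  rewrite gaps_max_rcons geq_max leF /=.
  have [/leM //|Mj] := ltnP j M.
  case: Mstk => [ME|stk0]; first by move: jb; rewrite -ME ltnNge Mj.
  by rewrite lastE // stk0 /= subnn.
- have [jb|bj] := ltnP j (g b); case=> leF _.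
    by move: leF; rewrite gaps_max_rcons geq_max => /andP[].
  by split=> // jM; move: (leq_trans jM Mb); rewrite ltnNge bj.
Qed.

(** At [M = 0] no gap is pending; taking each maximum in turn as the bound [v] yields both
    inequalities. *)
Lemma gap_inv_Delta (Xs : seq (seq nat)) b out i : uniq (flatten Xs) -> i < size Xs ->
  gap_inv (size Xs) (group Xs) (sort leq (flatten Xs)) b 0 out ->
  \max_(j < i.+1) out j = Delta Xs i.
Proof.
move=> uX ik inv; rewrite /Delta.
have maxP (f : nat -> nat) v :
    reflect (forall j, j <= i -> f j <= v) (\max_(j < i.+1) f j <= v).
  apply: (iffP (bigmax_leqP _ _ _)) => [le j ji|le j _].
    exact: (le (Ordinal (ji : j < i.+1))).
  by apply: le; rewrite -ltnS.
set D := fun j => maxgap (flatten (drop j Xs)).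
have DE j : gaps_max [seq x <- sort leq (flatten Xs) | j < group Xs x] = D j.
  by rewrite /D maxgap_suffix.
apply/eqP; rewrite eqn_leq; apply/andP; split.
- apply/(maxP out)/(inv _ _ ik) => j ji; split=> //; rewrite DE.
  exact: (elimT (maxP D _) (leqnn _)).
- apply/(maxP D) => j ji.
  by have /(inv _ _ ik)/(_ j ji)[] := elimT (maxP out _) (leqnn _); rewrite DE.
Qed.

(** * Reading the input layout *)

Lemma nth_flatten_pairs (I : Type) (f h : I -> nat) (s : seq I) i x0 :
  i < size s ->
  nth 0 (flatten [seq [:: f x; h x] | x <- s]) (i + i).+1 = h (nth x0 s i).
Proof.
elim: s i => [|x s IH] [|i] //= si.
by rewrite addnS -(IH i).
Qed.

Lemma size_flatten_pairs (I : Type) (f h : I -> nat) (s : seq I) :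
  size (flatten [seq [:: f x; h x] | x <- s]) = size s + size s.
Proof. by elim: s => //= x s ->; rewrite addnS. Qed.

Lemma out_addrE n (Xs : seq (seq nat)) :
  out_addr n Xs = 3 + size (flatten Xs) + size (flatten Xs) + size Xs + size Xs.
Proof.
rewrite /out_addr /input_layout !size_cat size_sort size_flatten_pairs size_iota /=.
by lia.
Qed.

Lemma layout_sorted n (Xs : seq (seq nat)) q : q < size (flatten Xs) ->
  nth 0 (input_layout n Xs) (3 + q) = nth 0 (sort leq (flatten Xs)) q.
Proof. by move=> qm; rewrite /input_layout /= nth_cat size_sort add0n qm. Qed.

Lemma layout_size n (Xs : seq (seq nat)) i : i < size Xs ->
  nth 0 (input_layout n Xs) (3 + size (flatten Xs) + i + i + 1) =
  size (nth [::] Xs i).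
Proof.
move=> ik.
have -> : 3 + size (flatten Xs) + i + i + 1 = 3 + (size (flatten Xs) + (i + i).+1).
  by lia.
rewrite /input_layout /= nth_cat size_sort add0n ltnNge leq_addr /= addKn nth_cat.
rewrite size_flatten_pairs size_iota ifT; last lia.
by rewrite (nth_flatten_pairs _ _ 0) ?size_iota // nth_iota.
Qed.

Lemma layout_list n (Xs : seq (seq nat)) q : q < size (flatten Xs) ->
  nth 0 (input_layout n Xs) (3 + size (flatten Xs) + size Xs + size Xs + q) =
  nth 0 (flatten Xs) q.
Proof.
move=> qm.
have -> : 3 + size (flatten Xs) + size Xs + size Xs + q =
          3 + (size (flatten Xs) + (size Xs + size Xs + q)) by lia.
rewrite /input_layout /= nth_cat size_sort add0n ltnNge leq_addr /= addKn nth_cat.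
by rewrite size_flatten_pairs size_iota ltnNge leq_addr /= addKn.
Qed.

Lemma nth_flatten_off (Xs : seq (seq nat)) i r :
  r < size (nth [::] Xs i) ->
  nth 0 (flatten Xs) (size (flatten (take i Xs)) + r) = nth 0 (nth [::] Xs i) r.
Proof.
elim: Xs i => [|X Xs IH] [|i] //= r_lt; rewrite ?nth_nil // in r_lt *.
- by rewrite nth_cat r_lt.
- by rewrite size_cat -addnA nth_cat ltnNge leq_addr /= addKn IH.
Qed.

Lemma size_flatten_takeS (Xs : seq (seq nat)) i :
  size (flatten (take i.+1 Xs)) =
  size (flatten (take i Xs)) + size (nth [::] Xs i).
Proof.
elim: Xs i => [|X Xs IH] [|i] //=; first by rewrite take0 cats0.
by rewrite !size_cat IH addnA.
Qed.

Lemma size_flatten_take_le (Xs : seq (seq nat)) i r :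
  r <= size (nth [::] Xs i) ->
  size (flatten (take i Xs)) + r <= size (flatten Xs).
Proof.
move=> le_r; apply: leq_trans (_ : size (flatten (take i.+1 Xs)) <= _).
  by rewrite size_flatten_takeS leq_add2l.
by rewrite -{2}(cat_take_drop i.+1 Xs) flatten_cat size_cat leq_addr.
Qed.

(** * The program *)

Notation reg r := (AReg r).
Notation "a :+ b" := (AAdd a b) (at level 50, left associativity).
Notation "c1 ;; c2" := (CSeq c1 c2) (at level 80, right associativity).

(* Registers: 0 = k, 1 = m, 2 = address of the outputs, 3 = address of the
   auxiliary array, 4 = loop index.  In [label_loop], 5 is the position in the
   current list and 6 the address being read.  In [scan_loop], 5 is [M], 6 the
   height of the stack, 7 the current element, 9 the top of the stack, and 8, 10
   their groups. *)
Definition setup :=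
  CAssign 0 (ALoad (ANum 1)) ;;
  CAssign 1 (ALoad (ANum 2)) ;;
  CAssign 2 (ANum 3 :+ reg 1 :+ reg 1 :+ reg 0 :+ reg 0) ;;
  CAssign 3 (reg 2 :+ reg 0) ;;
  CAssign 6 (ANum 3 :+ reg 1 :+ reg 0 :+ reg 0).

(** A flat loop instead of two nested ones: each iteration labels one element or moves to the next
    set, so one additive measure bounds it. *)
Definition label_loop :=
  CWhile (BLt (reg 4) (reg 0))
    (CIf (BLt (reg 5) (ALoad (ANum 3 :+ reg 1 :+ reg 4 :+ reg 4 :+ ANum 1)))
      (CStore (reg 3 :+ ALoad (reg 6)) (reg 4 :+ ANum 1) ;;
       CAssign 6 (reg 6 :+ ANum 1) ;;
       CAssign 5 (reg 5 :+ ANum 1))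
      (CAssign 4 (reg 4 :+ ANum 1) ;;
       CAssign 5 (ANum 0))).

(* The stack overwrites the already scanned part of the sorted sequence.
   [u + (v - u)] is [maxn u v] because subtraction is truncated. *)
Definition scan_loop :=
  CWhile (BLt (reg 4) (reg 1))
    (CAssign 7 (ALoad (ANum 3 :+ reg 4)) ;;
     CAssign 8 (ALoad (reg 3 :+ reg 7)) ;;
     CIf (BAnd (BLt (reg 5) (reg 8)) (BLt (ANum 0) (reg 6)))
       (CAssign 9 (ALoad (ANum 2 :+ reg 6)) ;;
        CAssign 10 (ALoad (reg 3 :+ reg 9)) ;;
        CStore (reg 2 :+ reg 5)
          (ALoad (reg 2 :+ reg 5) :+
           ASub (ASub (reg 7) (reg 9)) (ALoad (reg 2 :+ reg 5))) ;;
        CIf (BLt (reg 8) (reg 10))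
          (CAssign 5 (reg 8))
          (CAssign 5 (reg 10) ;;
           CAssign 6 (ASub (reg 6) (ANum 1))))
       (CStore (ANum 3 :+ reg 6) (reg 7) ;;
        CAssign 6 (reg 6 :+ ANum 1) ;;
        CAssign 4 (reg 4 :+ ANum 1) ;;
        CAssign 5 (ANum 0))).

Definition prefix_max_loop :=
  CWhile (BLt (reg 4) (reg 0))
    (CAssign 5 (reg 5 :+ ASub (ALoad (reg 2 :+ reg 4)) (reg 5)) ;;
     CStore (reg 2 :+ reg 4) (reg 5) ;;
     CAssign 4 (reg 4 :+ ANum 1)).

Definition chain_prefix_maxgap :=
  setup ;; label_loop ;;
  (CAssign 4 (ANum 0) ;; CAssign 5 (ANum 0) ;; CAssign 6 (ANum 0)) ;;
  scan_loop ;;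
  (CAssign 4 (ANum 0) ;; CAssign 5 (ANum 0)) ;;
  prefix_max_loop.

(** * Loop invariants and their preservation *)

Definition addressing (n : nat) (Xs : seq (seq nat)) (R : nat -> nat) :=
  [/\ R 0 = size Xs, R 1 = size (flatten Xs), R 2 = out_addr n Xs &
      R 3 = out_addr n Xs + size Xs].

Definition labelled (n : nat) (Xs : seq (seq nat)) (s : seq nat)
    (mem : nat -> nat) :=
  {in s, forall x, mem (out_addr n Xs + size Xs + x) = group Xs x}.

(** [off] counts the labelled elements, and [c] is the credit reserved for the rest of the
    program. *)
Definition label_inv n (Xs : seq (seq nat)) c (m : nat) (st : state) :=
  let i := st.1 4 in let r := st.1 5 in
  let off := size (flatten (take i Xs)) + r in
  [/\ addressing n Xs st.1,
      [/\ i <= size Xs, r <= size (nth [::] Xs i) &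
        st.1 6 = 3 + size (flatten Xs) + size Xs + size Xs + off],
      forall a, a < out_addr n Xs + size Xs -> st.2 a = nth 0 (input_layout n Xs) a,
      labelled n Xs (take off (flatten Xs)) st.2 &
      10 * (size (flatten Xs) - off + (size Xs - i)) + c < m].

Definition label_post n (Xs : seq (seq nat)) c (m : nat) (st : state) :=
  [/\ addressing n Xs st.1,
      forall a, a < out_addr n Xs + size Xs -> st.2 a = nth 0 (input_layout n Xs) a,
      labelled n Xs (flatten Xs) st.2 & c <= m].

Lemma label_loop_ok n (Xs : seq (seq nat)) c m st (Q : nat -> state -> Prop) :
  uniq (flatten Xs) -> all (fun x => 0 < x <= n) (flatten Xs) ->
  (forall m st, label_post n Xs c m st -> Q m st) ->
  label_inv n Xs c m st -> cwp (mem_bound n Xs) label_loop Q m st.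
Proof.
move=> uX /allP Xn HQ H0; exists (label_inv n Xs c) => // {st H0}m [R mem].
case=> /= -[R0 R1 R2 R3] [ik rX R6] memE lab cred; split; first lia.
have LE := out_addrE n Xs; have off_le := size_flatten_take_le rX.
rewrite R0; case: ltnP => ki; last first.
  have iE : R 4 = size Xs by lia.
  apply: HQ; split=> //=; last lia.
  move=> x xX; apply: lab; rewrite take_oversize //.
  by rewrite iE take_size leq_addr.
split; first lia.
have szE : mem (3 + R 1 + R 4 + R 4 + 1) = size (nth [::] Xs (R 4)).
  by rewrite memE ?R1 ?layout_size //; lia.
split; first by rewrite R1 /mem_bound; lia.
rewrite szE; case: ltnP => rlt.
- have off_lt : size (flatten (take (R 4) Xs)) + (R 5).+1 <= size (flatten Xs).
    exact: size_flatten_take_le.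
  have xE : mem (R 6) = nth 0 (nth [::] Xs (R 4)) (R 5).
    by rewrite memE R6 ?layout_list ?nth_flatten_off //; lia.
  have xX : nth 0 (nth [::] Xs (R 4)) (R 5) \in nth [::] Xs (R 4) by rewrite mem_nth.
  have /andP[x0 xn] : 0 < mem (R 6) <= n.
    by apply: Xn; rewrite xE; apply/flattenP; exists (nth [::] Xs (R 4)); rewrite ?mem_nth.
  split; first by rewrite R6 /mem_bound; lia.
  (* [x <= n] keeps this write inside the auxiliary array. *)
  split; first by rewrite R3 /mem_bound; lia.
  do 3![split; first lia].
  rewrite /upd; split=> //=; [by split=> //; lia| | |lia].
  + by move=> a aL; rewrite ifN ?memE //; lia.
  + rewrite addn1 addnS (take_nth 0); last lia.
    rewrite nth_flatten_off // => y; rewrite mem_rcons inE R3 eqn_add2l xE.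
    by case: eqP => [-> _|_ /= /lab //]; rewrite (group_nth (i := R 4)) ?addn1.
- do 2![split; first lia].
  have rE : R 5 = size (nth [::] Xs (R 4)) by lia.
  rewrite /upd; split=> //=; rewrite !addn1 size_flatten_takeS addn0 -rE //.
  lia.
Qed.

(* In the credit bound, a push costs one unit of [size stk] and possibly re-raises
   the boolean but advances [i]; the other iterations lower [size stk] or the
   boolean. *)
Definition scan_inv n (Xs : seq (seq nat)) c (m : nat) (st : state) :=
  let S := sort leq (flatten Xs) in let g := group Xs in
  let i := st.1 4 in let M := st.1 5 in
  exists stk : seq nat, [/\ addressing n Xs st.1,
    [/\ i <= size S, st.1 6 = size stk, size stk <= i, {subset stk <= S} &
      i < size S -> M <= g (nth 0 S i)],
    [/\ forall q, q < size stk -> st.2 (3 + q) = nth 0 stk q,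
        forall q, i <= q < size S -> st.2 (3 + q) = nth 0 S q &
        labelled n Xs (flatten Xs) st.2],
    stack_inv g (take i S) M stk /\
    gap_inv (size Xs) g (take i S) (nth 0 S i) M
      (fun j => st.2 (out_addr n Xs + j)) /\ (i = size S -> M = 0) &
    20 * (3 * (size S - i) + size stk + (M < g (nth 0 S i))) + c < m].

Definition scan_post n (Xs : seq (seq nat)) c (m : nat) (st : state) :=
  [/\ addressing n Xs st.1,
      gap_inv (size Xs) (group Xs) (sort leq (flatten Xs)) 0 0
        (fun j => st.2 (out_addr n Xs + j)) & c <= m].

Lemma scan_loop_ok n (Xs : seq (seq nat)) c m st (Q : nat -> state -> Prop) :
  all (fun x => 0 < x <= n) (flatten Xs) ->
  (forall m st, scan_post n Xs c m st -> Q m st) ->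
  scan_inv n Xs c m st -> cwp (mem_bound n Xs) scan_loop Q m st.
Proof.
move=> /allP Xn HQ H0; exists (scan_inv n Xs c) => // {st H0}m [R mem].
case=> stk /= [[R0 R1 R2 R3] [im R6 stki stkS Mb] [stkE SE lab] [sinv [ginv M0]] cred].
split; first lia.
have LE := out_addrE n Xs.
have memS x : (x \in sort leq (flatten Xs)) = (x \in flatten Xs) by rewrite mem_sort.
have szS : size (sort leq (flatten Xs)) = size (flatten Xs) by rewrite size_sort.
set S := sort leq (flatten Xs) in im stkS Mb SE sinv ginv M0 cred memS szS *.
rewrite R1 -szS; case: ltnP => mi; last first.
  have iE : R 4 = size S by lia.
  (* Past the end, the pending element is the default 0 of [nth], as in [scan_post]. *)
  apply: HQ; split=> //=; last lia.
  by move: ginv; rewrite iE take_size nth_default // M0.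
set b := nth 0 S (R 4) in Mb ginv cred *.
have bS : b \in S by rewrite mem_nth.
have bX : b \in flatten Xs by rewrite -memS.
have bE : mem (3 + R 4) = b by rewrite SE ?leqnn.
have gbE : mem (R 3 + b) = group Xs b by rewrite R3 lab.
have gbk := group_le bX; have {}Mb := Mb mi.
have /andP[b0 bn] := Xn _ bX.
rewrite /upd /= bE gbE; split; first by rewrite /mem_bound; lia.
split; first lia.
split; first by rewrite R3 /mem_bound; lia.
do 2![split; first lia].
have [/andP[Mgb tp]|nMgb] /= := boolP ((R 5 < group Xs b) && (0 < R 6)).
- case/lastP: stk stki stkS stkE sinv R6 cred => [|stk a].
    by move=> _ _ _ _ R6; move: tp; rewrite R6.
  rewrite size_rcons => stki stkS stkE sinv R6 cred.
  have aX : a \in flatten Xs by rewrite -memS stkS // mem_rcons mem_head.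
  have gak := group_le aX; have /andP[a0 an] := Xn _ aX.
  have aE : mem (2 + R 6) = a.
    have -> : 2 + R 6 = 3 + size stk by lia.
    by rewrite stkE // nth_rcons ltnn eqxx.
  have gaE : mem (R 3 + a) = group Xs a by rewrite R3 lab.
  have Mga : R 5 < group Xs a.
    by case: sinv; rewrite all_rcons => /andP[].
  (* For thresholds from [M] up to both labels, [a] is the predecessor of [b]; hence the next [M] is
     the smaller label. *)
  have lastE : forall j, R 5 <= j < minn (group Xs a) (group Xs b) ->
      last b [seq x <- take (R 4) S | j < group Xs x] = a.
    move=> j jM; apply: stack_inv_last sinv; lia.
  rewrite aE gaE R2; split; first by rewrite /mem_bound; lia.
  split; first lia.
  split; first by rewrite R3 /mem_bound; lia.
  split; first lia.
  do 3![split; first by rewrite /mem_bound; lia].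
  do 2![split; first lia].
  rewrite -maxnE; set mem' := fun y => if y == out_addr n Xs + R 5 then _ else _.
  have ginv' : gap_inv (size Xs) (group Xs) (take (R 4) S) b
      (minn (group Xs a) (group Xs b)) (fun j => mem' (out_addr n Xs + j)).
    apply: gap_inv_advance ginv; [| |exact: lastE|]; try lia.
    by move=> j jk; rewrite /mem' eqn_add2l; case: eqP.
  have labE : labelled n Xs (flatten Xs) mem'.
    by move=> x xX; rewrite /mem' ifN ?lab //; lia.
  have SE' q : R 4 <= q < size S -> mem' (3 + q) = nth 0 S q.
    by move=> qS; rewrite /mem' ifN ?SE //; lia.
  have stkE' q : q < size stk -> mem' (3 + q) = nth 0 stk q.
    move=> qs; rewrite /mem' ifN; last lia.
    by rewrite stkE ?size_rcons ?nth_rcons ?qs //; lia.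
  (* If [g b < g a], then [a] stays and [b] is fully compared; otherwise [a] is popped. *)
  case: ltnP => gba; (split; first lia).
  + exists (rcons stk a); split=> //=; rewrite ?size_rcons -/S -/b; last lia.
    * by split=> // _; lia.
    * split=> // q; rewrite ltnS leq_eqVlt nth_rcons => /predU1P[->|qs].
        rewrite ltnn eqxx /mem' ifN ?stkE ?size_rcons ?nth_rcons ?ltnn ?eqxx //.
        lia.
      by rewrite qs stkE'.
    * split; first by apply: stack_inv_stop sinv; lia.
      by split; [rewrite (minn_idPr (ltnW gba)) in ginv'|lia].
  + split; first lia.
    exists stk; split=> //=; rewrite -/S -/b; last lia.
    * split=> //; try lia.
      by move=> x xs; apply: stkS; rewrite mem_rcons inE xs orbT.
    * split; first exact: stack_inv_pop sinv.
      by split; [rewrite (minn_idPl gba) in ginv'|lia].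
- have done_b : R 5 = group Xs b \/ stk = [::].
    case: (stk) R6 => [|? ?] R6; [by right|left].
    by move: nMgb; rewrite R6 andbT; lia.
  have takeE : take (R 4 + 1) S = rcons (take (R 4) S) b.
    by rewrite addn1 (take_nth 0).
  split; first by rewrite /mem_bound; lia.
  do 4![split; first lia].
  (* The stack height is at most [i], so the push overwrites only a scanned cell. *)
  set mem' := fun y => if y == 3 + R 6 then _ else _.
  exists (rcons stk b); rewrite /= size_rcons -/S; split=> //=.
  + split; try lia.
    by move=> x; rewrite mem_rcons inE => /predU1P[->|/stkS].
  + split.
    * move=> q; rewrite /mem' R6 eqn_add2l nth_rcons ltnS leq_eqVlt.
      by case: eqP => [->|_ /= qs]; rewrite ?ltnn ?eqxx // qs stkE.
    * by move=> q qS; rewrite /mem' ifN ?SE //; lia.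
    * by move=> x xX; rewrite /mem' ifN ?lab //; lia.
  + rewrite takeE; split; first exact: stack_inv_push done_b sinv.
    split=> // i v ik; have := gap_inv_push (nth 0 S (R 4 + 1)) Mb done_b sinv ginv v ik.
    move=> <-; split=> le j ji; have := le j ji; rewrite /mem' ifN //; lia.
  + lia.
Qed.

Definition prefix_max_inv n (Xs : seq (seq nat)) (f : nat -> nat) (m : nat) (st : state) :=
  let i := st.1 4 in
  [/\ addressing n Xs st.1, i <= size Xs, st.1 5 = \max_(j < i) f j,
    forall q, q < size Xs -> st.2 (out_addr n Xs + q) =
       if q < i then \max_(j < q.+1) f j else f q &
    10 * (size Xs - i) < m].

Lemma prefix_max_loop_ok n (Xs : seq (seq nat)) (f : nat -> nat) m st (Q : nat -> state -> Prop) :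
  (forall m st,
     (forall q, q < size Xs ->
        st.2 (out_addr n Xs + q) = \max_(j < q.+1) f j) -> Q m st) ->
  prefix_max_inv n Xs f m st -> cwp (mem_bound n Xs) prefix_max_loop Q m st.
Proof.
move=> HQ H0; exists (prefix_max_inv n Xs f) => // {st H0}m [R mem].
case=> /= -[R0 R1 R2 R3] ik R5 memE cred; split; first lia.
rewrite R0; case: ltnP => ki; last first.
  by apply: HQ => q qk /=; rewrite memE // (leq_trans qk).
rewrite /upd /= R2; split; first by rewrite /mem_bound; lia.
split; first lia.
split; first by rewrite /mem_bound; lia.
do 2![split; first lia].
split=> //=; [lia| | |lia].
- by rewrite addn1 big_ord_recr /= maxnE R5 memE // ltnn.
- move=> q qk; rewrite eqn_add2l addn1 ltnS leq_eqVlt.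
  case: eqP => [->|_] /=; last exact: memE.
  by rewrite big_ord_recr /= maxnE R5 memE // ltnn.
Qed.

(** * Assembling the phases *)

Lemma cwp_seq B c1 c2 Q : cwp B (c1 ;; c2) Q = cwp B c1 (cwp B c2 Q).
Proof. by []. Qed.

Lemma chain_prefix_maxgap_ok n (Xs : seq (seq nat)) :
  uniq (flatten Xs) -> all (fun x => 0 < x <= n) (flatten Xs) ->
  cwp (mem_bound n Xs) chain_prefix_maxgap
    (fun _ st => forall i, i < size Xs -> st.2 (out_addr n Xs + i) = Delta Xs i)
    (100 * (size (flatten Xs) + size Xs + 1)) (init_state n Xs).
Proof.
move=> uX Xn; have LE := out_addrE n Xs.
set k := size Xs in LE *; set m := size (flatten Xs) in LE *.
(* [c2] pays for the prefix-maximum phase. [c1] adds the scan, whose initial potential is at most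
   [3 * m + 1], and the register resets. *)
pose c2 := 10 * k + 10; pose c1 := 20 * (3 * m + 1) + c2 + 10.
rewrite /chain_prefix_maxgap !cwp_seq.
set rest := cwp _ label_loop _; rewrite /= /upd /= -/k -/m.
do 2!(split; [by rewrite /mem_bound; lia|split; first lia]).
do 3![split; first lia].
rewrite {}/rest; apply: (@label_loop_ok n Xs c1) => //; last first.
  rewrite /label_inv /= take0 /=; rewrite -/k -/m; split=> //; last by rewrite /c1 /c2; lia.
  - by split=> //=; lia.
  - by split=> //=; lia.
  - by move=> x; rewrite take0.
move=> {}m' [R mem] post; set rest := cwp _ scan_loop _.
case: post => /= -[R0 R1 R2 R3] memE lab cred; rewrite /upd /=.
do 3![split; first lia].
rewrite {}/rest; apply: (@scan_loop_ok n Xs c2) => //; last first.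
  exists [::]; rewrite /= take0; split=> //=.
  - split=> // q qm; rewrite memE ?layout_sorted //; move: qm; rewrite size_sort; lia.
  - split; first by [].
    split=> // i v ik; split=> le j ji //.
    (* The output cells lie just past the layout, so they still read as the default 0. *)
    rewrite memE; last lia.
    by rewrite nth_default // leq_addr.
  - rewrite size_sort -/m; move: cred; rewrite /c1; lia.
move=> m2 [R' mem'] post; set rest := cwp _ prefix_max_loop _.
case: post => /= -[R0' R1' R2' R3'] ginv cred2; rewrite /upd /=.
do 2![split; first lia].
rewrite {}/rest; apply: (@prefix_max_loop_ok n Xs (fun j => mem' (out_addr n Xs + j))).
  by move=> m3 st memE' i ik; rewrite memE' // (gap_inv_Delta uX ik ginv).
split=> //=; [by rewrite big_ord0 | move: cred2; rewrite /c2; lia].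
Qed.

Theorem theorem7 :
  exists (P : cmd) (c : nat),
  forall (n : nat) (Xs : seq (seq nat)),
    uniq (flatten Xs) ->
    all (fun x => 0 < x <= n) (flatten Xs) ->
    exists (t : nat) (st' : state),
      exec (mem_bound n Xs) P (init_state n Xs) t st' /\
      t <= c * (size (flatten Xs) + size Xs + 1) /\
      (forall i, i < size Xs -> st'.2 (out_addr n Xs + i) = Delta Xs i).
Proof.
exists chain_prefix_maxgap, 100 => n Xs uX Xn.
have [t [st' [ex le_t ok]]] := cwp_sound (chain_prefix_maxgap_ok uX Xn).
by exists t, st'.
Qed.
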